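(* Let $\mu$ be a directed distance on $S$. (1) $\mathrm{MFP}^*(\mu;G,S,c)=\mathrm{FLP}^*(T_\mu;G,S,c)$ for every network $(G,S,c)$ with terminal set $S$. (2) $\mathrm{MFP}^*(\mu;G,S,c)=\mathrm{FLP}^*(R;G,S,c)$ for every balanced section $R$ contained in $Q_\mu^+$ and every inner Eulerian network $(G,S,c)$ with terminal set $S$.
   Context: A network $(G,S,c)$ consists of a finite directed graph $G=(VG,EG)$, a terminal set $S\subseteq VG$, and a capacity $c:EG\to\mathbb Z_+$. An $S$-path is a directed path joining two distinct terminals. A multiflow is a pair $(\mathcal P,\lambda)$ of a set $\mathcal P$ of $S$-paths and $\lambda:\mathcal P\to\mathbb R_+$ with $\sum\{\lambda(P):P\ni e\}\le c(e)$ for all $e\in EG$. A directed distance on $S$ is $\mu:S\times S\to\mathbb R_+$ with $\mu(s,s)=0$. $\mathrm{MFP}^*(\mu;G,S,c)$ is the maximum over multiflows of $\sum_P\lambda(P)\mu(s_P,t_P)$ ($s_P,t_P$ the start and end of $P$). A node $x$ fulfills the Eulerian condition if the total capacity of edges leaving $x$ equals that of edges entering $x$; the network is inner Eulerian if every non-terminal node fulfills it. Let $S^c,S^r$ be disjoint copies of $S$ (elements $s^c,s^r$), $S^{cr}=S^c\cup S^r$, and for $p\in\mathbb R^{S^{cr}}$ let $p^c,p^r$ be its restrictions. For vectors, $p\le q$ is coordinatewise and $p<q$ means strict inequality in every coordinate; a point $p$ of a set $P$ is minimal if there is no $q\in P$, $q\ne p$, with $q\le p$. $P_\mu=\{p\in\mathbb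 R^{S^{cr}}:p(s^c)+p(t^r)\ge\mu(s,t)\ \forall s,t\}$; $T_\mu$ is the set of minimal elements of $P_\mu^+$ (the nonnegative points of $P_\mu$) and $Q_\mu$ the set of minimal elements of $P_\mu$; $Q_\mu^+$ is the set of nonnegative points of $Q_\mu$. Let $L=\mathbb R(\mathbf 1,-\mathbf 1)$ be the line spanned by the vector equal to $1$ on $S^c$ and $-1$ on $S^r$. A section is a subset $R\subseteq Q_\mu$ such that $p\mapsto p+L$ is a bijection from $R$ onto $Q_\mu/L$. A set $R$ is balanced if there are no $p,q\in R$ with $p^c<q^c$ or $p^r<q^r$. $D^+_\infty(p,q)=\max_x\max\{q(x)-p(x),0\}$ on $\mathbb R^X$; $D_\infty(p,q)=\max\{D^+_\infty(p^c,q^c),D^+_\infty(q^r,p^r)\}$ on $\mathbb R^{S^{cr}}$. For $R\subseteq P_\mu$ and $s\in S$, $R_s=\{p\in R:p(s^c)+p(s^r)=0\}$, and $\mathrm{FLP}^*(R;G,S,c)$ is the minimum of $\sum_{xy\in EG}c(xy)D_\infty(\rho(x),\rho(y))$ over maps $\rho:VG\to R$ with $\rho(s)\in R_s$ for all $s\in S$. *)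

(* Defs.v *)
From HB Require Import structures.
From mathcomp Require Import all_boot all_order all_algebra finmap.
From mathcomp Require Import boolp classical_sets functions reals.

Set Implicit Arguments.
Unset Strict Implicit.
Unset Printing Implicit Defensive.

Import Order.TTheory GRing.Theory Num.Theory.
Local Open Scope classical_set_scope.
Local Open Scope ring_scope.

(* Edges form a type of their own, so parallel edges (and loops) are allowed.
   The terminal set is given by an injection [term] of [S] into the nodes, so
   that a distance on [S] can be fixed independently of the network. *)
Record network (S : finType) := Network {
  node : finType;
  edge : finType;
  esrc : edge -> node;
  etgt : edge -> node;
  term : S -> node;
  term_inj : injective term;
  cap : edge -> nat
}.

Section Network.
Variables (S : finType) (N : network S).

Definition inner_eulerian : Prop :=
  forall x : node N, x \notin codom (@term S N) ->
    (\sum_(e | esrc e == x) cap e = \sum_(e | etgt e == x) cap e)%N.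

(* A path is the list of its edges and visits no node twice; it may go through
   terminals other than its two ends. *)
Definition is_spath (s t : S) (p : seq (edge N)) : bool :=
  if p is e :: p' then
    [&& s != t,
        esrc e == term N s,
        path (fun f g => etgt f == esrc g) e p',
        etgt (last e p') == term N t
      & uniq (esrc e :: [seq etgt f | f <- p])]
  else false.

Definition spath := {P : S * S * seq (edge N) | is_spath P.1.1 P.1.2 P.2}.

Definition path_start (P : spath) : S := (val P).1.1.
Definition path_end (P : spath) : S := (val P).1.2.
Definition path_edges (P : spath) : seq (edge N) := (val P).2.

End Network.

Section Multiflow.
Variables (R : realType) (S : finType) (mu : S -> S -> R).

Definition directed_distance : Prop :=
  (forall s t, 0 <= mu s t) /\ (forall s, mu s s = 0).

(* Only the values of [lam] on [PP] matter. *)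
Definition is_multiflow (N : network S) (PP : {fset spath N})
    (lam : spath N -> R) : Prop :=
  (forall P, P \in PP -> 0 <= lam P) /\
  (forall e : edge N,
     \sum_(P <- PP | e \in path_edges P) lam P <= (cap e)%:R).

Definition flow_value (N : network S) (PP : {fset spath N})
    (lam : spath N -> R) : R :=
  \sum_(P <- PP) lam P * mu (path_start P) (path_end P).

Definition is_max (A : set R) (v : R) : Prop := A v /\ ubound A v.
Definition is_min (A : set R) (v : R) : Prop := A v /\ lbound A v.

Definition is_MFP (N : network S) (v : R) : Prop :=
  is_max [set w | exists PP : {fset spath N}, exists lam : spath N -> R,
             is_multiflow PP lam /\ w = flow_value PP lam] v.

End Multiflow.

Section Points.
Variables (R : realType) (S : finType).

(* Vectors indexed by S^cr: [inl s] stands for s^c and [inr s] for s^r. *)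
Definition crvec := (S + S)%type -> R.

Definition cpart (p : crvec) : S -> R := fun s => p (inl s).
Definition rpart (p : crvec) : S -> R := fun s => p (inr s).

Definition vle (X : finType) (p q : X -> R) : Prop := forall x, p x <= q x.
Definition vlt (X : finType) (p q : X -> R) : Prop := forall x, p x < q x.

Definition nonneg : set crvec := [set p | forall x, 0 <= p x].

Definition minimals (A : set crvec) : set crvec :=
  [set p | A p /\ ~ exists q, [/\ A q, q <> p & vle q p]].

Definition Pmu (mu : S -> S -> R) : set crvec :=
  [set p | forall s t, mu s t <= p (inl s) + p (inr t)].
Definition Tmu (mu : S -> S -> R) : set crvec := minimals (Pmu mu `&` nonneg).
Definition Qmu (mu : S -> S -> R) : set crvec := minimals (Pmu mu).
Definition Qmu_nonneg (mu : S -> S -> R) : set crvec := Qmu mu `&` nonneg.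

Definition Ldir : crvec := fun x => if x is inl _ then 1 else -1.
Definition Lcoset (p : crvec) : set crvec :=
  [set q | exists a : R, forall x, q x = p x + a * Ldir x].

(* The quotient Q_mu / L is the set [Lcoset @` Qmu mu] of cosets. *)
Definition is_section (mu : S -> S -> R) (A : set crvec) : Prop :=
  A `<=` Qmu mu /\ set_bij A (Lcoset @` Qmu mu) Lcoset.

Definition balanced (A : set crvec) : Prop :=
  ~ exists p q, [/\ A p, A q
                  & vlt (cpart p) (cpart q) \/ vlt (rpart p) (rpart q)].

Definition Dplus (X : finType) (p q : X -> R) : R :=
  \big[Num.max/0]_(x : X) Num.max (q x - p x) 0.

(* The two arguments are swapped in the second component. *)
Definition Dinf (p q : crvec) : R :=
  Num.max (Dplus (cpart p) (cpart q)) (Dplus (rpart q) (rpart p)).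

Definition at_terminal (A : set crvec) (s : S) : set crvec :=
  A `&` [set p | p (inl s) + p (inr s) = 0].

Definition is_location (A : set crvec) (N : network S)
    (rho : node N -> crvec) : Prop :=
  (forall x, A (rho x)) /\ (forall s, at_terminal A s (rho (term N s))).

Definition location_cost (N : network S) (rho : node N -> crvec) : R :=
  \sum_(e : edge N) (cap e)%:R * Dinf (rho (esrc e)) (rho (etgt e)).

Definition is_FLP (A : set crvec) (N : network S) (v : R) : Prop :=
  is_min [set w | exists rho : node N -> crvec,
             is_location A rho /\ w = location_cost rho] v.

End Points.

(* Main.v *)
(* By linear programming duality MFP* is the minimum of [sum c(e) l(e)] over the
   nonnegative edge lengths [l] giving every S-path from [s] to [t] length at
   least [mu s t]. A location [rho] yields such lengths [Dinf (rho x) (rho y)],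
   since the s^c-coordinate telescopes along a path. Conversely, from [l] the
   truncated distances from and to the terminals give a map into [Pmu] whose
   edges are no longer than [l]; it remains to push it into the required set
   without increasing the cost. For [Tmu], lowering all c-coordinates, then all
   r-coordinates, as far as possible (keeping them nonnegative) is a
   nonexpansive retraction. For a balanced section, the same without the sign
   constraint retracts onto [Qmu]; translating along [L] into the section then
   changes the cost of each edge [xy] by at most a potential difference
   [a y - a x], and these cancel in an inner Eulerian network because [a]
   vanishes at the terminals. *)

Require Import Defs.
From mathcomp Require Import all_boot all_order all_algebra finmap.
From mathcomp Require Import boolp classical_sets functions reals.
From mathcomp Require Import lra.

Set Implicit Arguments.
Unset Strict Implicit.
Unset Printing Implicit Defensive.

Import Order.TTheory GRing.Theory Num.Theory.
Local Open Scope classical_set_scope.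
Local Open Scope ring_scope.

(** * Linear programming duality *)

Lemma sum_mulD (R : realFieldType) (J : finType) (a x y : J -> R) (k : R) :
  \sum_j a j * (x j + k * y j) = \sum_j a j * x j + k * \sum_j a j * y j.
Proof.
rewrite mulr_sumr -big_split; apply: eq_bigr => j _ /=.
by rewrite mulrDr mulrCA.
Qed.

(* Induction on the number of constraints, after Bartl: if the last
   constraint [i] is not redundant, some [x0] with [a_i(x0) > 0] violates only
   it, and [x |-> x - (a_i(x) / a_i(x0)) x0] maps onto its kernel, where the
   other constraints suffice. *)
Lemma farkas (R : realFieldType) (I : eqType) (J : finType) (s : seq I)
    (a : I -> J -> R) (g : J -> R) : uniq s ->
  (forall x : J -> R, (forall i, i \in s -> \sum_j a i j * x j <= 0) ->
     \sum_j g j * x j <= 0) ->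
  exists lam : I -> R, (forall i, 0 <= lam i) /\
    forall j, g j = \sum_(i <- s) lam i * a i j.
Proof.
elim: s a g => [|i s IHs] a g /=.
  move=> _ /(_ g) H; exists (fun=> 0); split=> // j; rewrite big_nil.
  have {}H : \sum_j g j * g j <= 0 by apply: H.
  have g2 k : 0 <= g k * g k by rewrite -expr2 sqr_ge0.
  have : \sum_j g j * g j == 0 by rewrite eq_le H sumr_ge0.
  rewrite psumr_eq0 // => /allP /(_ j); rewrite mem_index_enum => /(_ isT).
  by rewrite /= mulf_eq0 orbb => /eqP.
case/andP=> iNs us H.
have extend (c : R) (lam : I -> R) (f : I -> R) :
    \sum_(k <- i :: s) (if k == i then c else lam k) * f k =
    c * f i + \sum_(k <- s) lam k * f k.
  rewrite big_cons eqxx; congr (_ + _); apply: eq_big_seq => k ks.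
  by case: eqVneq ks iNs => // -> ->.
have [Hs|/existsNP[x0 /not_implyP[Hx0 /negP]]] := pselect (forall x : J -> R,
    (forall k, k \in s -> \sum_j a k j * x j <= 0) -> \sum_j g j * x j <= 0).
  have [lam [lam0 Hlam]] := IHs a g us Hs.
  exists (fun k => if k == i then 0 else lam k); split=> [k|j].
    by case: ifP.
  by rewrite (extend 0 lam (a^~ j)) mul0r add0r.
rewrite -ltNge => gx0.
have ax0 : 0 < \sum_j a i j * x0 j.
  rewrite ltNge; apply/negP => ax0; move: gx0; rewrite ltNge => /negP; apply.
  by apply: H => k; rewrite inE => /predU1P[->|/Hx0].
set w := \sum_j a i j * x0 j in ax0.
pose A k := \sum_j a k j * x0 j.
pose G := \sum_j g j * x0 j.
(* Projecting [x] along [x0] onto the kernel of [a i] is transferred to the functionals: each [f]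
   loses the multiple of [a i] that makes it vanish at [x0]. *)
have proj (f : J -> R) x :
    \sum_j (f j - (\sum_j f j * x0 j) / w * a i j) * x j =
    \sum_j f j * (x j + (- ((\sum_j a i j * x j) / w)) * x0 j).
  rewrite sum_mulD; set F := \sum_j f j * x0 j; pose F' := F / w; rewrite -/F'.
  under eq_bigr do rewrite mulrBl -mulrA.
  by rewrite sumrB -mulr_sumr /F'; lra.
have [|lam [lam0 Hlam]] := IHs (fun k j => a k j - A k / w * a i j)
    (fun j => g j - G / w * a i j) us.
  move=> x Hx; rewrite proj; apply: H => k; rewrite inE => /predU1P[->|ks].
    by rewrite sum_mulD -/w mulNr divfK ?gt_eqF // subrr.
  by rewrite -proj; apply: Hx.
(* The multiplier of [i] collects the multiples of [a i] subtracted above; it is nonnegative since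
   [G > 0] and [A k <= 0] for [k] in [s]. *)
exists (fun k => if k == i then G / w - \sum_(k <- s) lam k * (A k / w) else lam k).
split=> [k|j].
  case: ifP => // _; rewrite subr_ge0 (@le_trans _ _ 0) //; last first.
    by rewrite divr_ge0 // ltW.
  rewrite big_seq; apply: sumr_le0 => l ls; apply: mulr_ge0_le0 => //.
  by rewrite pmulr_lle0 ?invr_gt0 //; apply: Hx0.
rewrite (extend _ lam (a^~ j)).
have := Hlam j; under eq_bigr do rewrite mulrBr mulrA.
rewrite sumrB -mulr_suml; lra.
Qed.

Lemma sum_mulC (R : realFieldType) (I J : finType) (y : I -> R) (B : I -> J -> R)
    (x : J -> R) :
  \sum_j (\sum_i y i * B i j) * x j = \sum_i y i * \sum_j B i j * x j.
Proof.
under eq_bigr do rewrite mulr_suml.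
rewrite exchange_big; apply: eq_bigr => i _.
by rewrite mulr_sumr; apply: eq_bigr => j _; rewrite mulrA.
Qed.

Lemma sum_add_unit (R : realFieldType) (J : finType) (f : J + unit -> R) :
  \sum_l f l = \sum_j f (inl j) + f (inr tt).
Proof. by rewrite big_sumType /=; congr (_ + _); rewrite (big_pred1 tt) // => -[]. Qed.

(** Homogenization: a new coordinate carries [- b]. If the constraints let it be positive, rescaling
    it to 1 solves the system; otherwise [farkas] yields [y]. *)
Lemma farkas_nonneg (R : realFieldType) (I J : finType)
    (B : I -> J -> R) (b : I -> R) :
  (exists x : J -> R, (forall j, 0 <= x j) /\
     forall i, \sum_j B i j * x j <= b i) \/
  (exists y : I -> R, [/\ forall i, 0 <= y i,
     forall j, 0 <= \sum_i y i * B i j & \sum_i y i * b i < 0]).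
Proof.
pose a (k : I + J) (l : J + unit) : R :=
  match k, l with
  | inl i, inl j => B i j
  | inl i, inr _ => - b i
  | inr j, inl j' => - (j == j')%:R
  | inr j, inr _ => 0
  end.
pose g (l : J + unit) : R := (l == inr tt)%:R.
have sum_g x : \sum_l g l * x l = x (inr tt).
  rewrite sum_add_unit /= mul1r big1 ?add0r // => j _; exact: mul0r.
have sum_inr j (x : J + unit -> R) :
    \sum_l a (inr j) l * x l = - x (inl j).
  rewrite sum_add_unit /= mul0r addr0 (bigD1 j) //= eqxx big1 ?addr0 ?mulN1r //.
  by move=> k /negPf; rewrite eq_sym => ->; rewrite oppr0 mul0r.
have [/existsNP[x /not_implyP[Hx /negP]]|H] := pselect (~ forall x : J + unit -> R,
    (forall k, k \in index_enum (I + J)%type -> \sum_l a k l * x l <= 0) ->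
    \sum_l g l * x l <= 0).
  rewrite sum_g -ltNge => x0; left; exists (fun j => x (inl j) / x (inr tt)).
  split=> [j|i].
    rewrite divr_ge0 ?(ltW x0) //.
    by have := Hx (inr j); rewrite sum_inr oppr_le0 mem_index_enum; apply.
  have := Hx (inl i); rewrite sum_add_unit /= mem_index_enum => /(_ isT).
  under [X in _ -> X <= _]eq_bigr do rewrite mulrA.
  by rewrite -mulr_suml ler_pdivrMr //; lra.
move/contrapT: H => /(farkas (index_enum_uniq _))[lam [lam0 Hlam]].
right; exists (fun i => lam (inl i)); split=> // [j|].
  have := Hlam (inl j); rewrite big_sumType /= (bigD1 j) //= eqxx.
  rewrite [X in _ + (_ + X)]big1 => [|k /negPf ->]; last by rewrite oppr0 mulr0.
  by have := lam0 (inr j); rewrite /g /=; lra.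
have := Hlam (inr tt); rewrite big_sumType /= [X in _ + X]big1 => [|k _]; last first.
  by rewrite mulr0.
under eq_bigr do rewrite mulrN.
by rewrite sumrN /g /=; have := @ltr01 R; lra.
Qed.

(** Primal feasibility, dual feasibility and the reverse of weak duality form one system, and a
    certificate of its infeasibility is refuted. *)
Lemma lp_duality (R : realFieldType) (I J : finType)
    (A : I -> J -> R) (b : I -> R) (c : J -> R) (x0 : J -> R) (y0 : I -> R) :
  (forall j, 0 <= x0 j) -> (forall i, \sum_j A i j * x0 j <= b i) ->
  (forall i, 0 <= y0 i) -> (forall j, c j <= \sum_i y0 i * A i j) ->
  exists x y,
    [/\ forall j, 0 <= x j, forall i, \sum_j A i j * x j <= b i,
        forall i, 0 <= y i, forall j, c j <= \sum_i y i * A i j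
      & \sum_i y i * b i <= \sum_j c j * x j].
Proof.
move=> x00 Hx0 y00 Hy0.
pose B (k : (I + J) + unit) (l : J + I) : R :=
  match k, l with
  | inl (inl i), inl j => A i j
  | inl (inr j), inr i => - A i j
  | inr _, inl j => - c j
  | inr _, inr i => b i
  | _, _ => 0
  end.
pose d (k : (I + J) + unit) : R :=
  match k with inl (inl i) => b i | inl (inr j) => - c j | inr _ => 0 end.
have [[z [z0 Hz]]|[w [w0 Hw Hwd]]] := @farkas_nonneg R _ _ B d.
  exists (fun j => z (inl j)), (fun i => z (inr i)); split=> // [i|j|].
  - have := Hz (inl (inl i)); rewrite big_sumType /= [X in _ + X]big1 ?addr0 //.
    by move=> k _; rewrite mul0r.
  - have := Hz (inl (inr j)); rewrite big_sumType /= [X in X + _]big1; last first.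
      by move=> k _; rewrite mul0r.
    under eq_bigr do rewrite mulNr mulrC.
    by rewrite sumrN add0r lerN2.
  - have := Hz (inr tt); rewrite big_sumType /=.
    under eq_bigr do rewrite mulNr.
    under [X in _ + X]eq_bigr do rewrite mulrC.
    by rewrite sumrN; lra.
pose y i := w (inl (inl i)); pose u j := w (inl (inr j)); pose t := w (inr tt).
have t0 : 0 <= t by apply: w0.
have y_ge0 i : 0 <= y i by apply: w0.
have u_ge0 j : 0 <= u j by apply: w0.
have sumw (f : (I + J) + unit -> R) : \sum_k w k * f k =
    \sum_i y i * f (inl (inl i)) + \sum_j u j * f (inl (inr j)) + t * f (inr tt).
  by rewrite sum_add_unit big_sumType.
have Hy j : t * c j <= \sum_i y i * A i j.
  have := Hw (inl j); rewrite sumw /= [X in _ + X + _]big1; last first.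
    by move=> k _; rewrite mulr0.
  by lra.
have Hu i : \sum_j A i j * u j <= t * b i.
  have := Hw (inr i); rewrite sumw /= [X in X + _ + _]big1; last first.
    by move=> k _; rewrite mulr0.
  under eq_bigr do rewrite mulrN mulrC.
  by rewrite sumrN; lra.
have {Hwd} Hyu : \sum_i y i * b i < \sum_j c j * u j.
  move: Hwd; rewrite sumw /=.
  under [X in _ + X + _]eq_bigr do rewrite mulrN mulrC.
  by rewrite sumrN; lra.
have le1 : \sum_j (t * c j) * u j <= \sum_i y i * (t * b i).
  apply: (@le_trans _ _ (\sum_j (\sum_i y i * A i j) * u j)).
    by apply: ler_sum => j _; apply: ler_wpM2r.
  by rewrite sum_mulC; apply: ler_sum => i _; apply: ler_wpM2l.
(* [t] is the multiplier of the objective row. If it vanishes, [u] and [y] are recession directions,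
   for which [x0] and [y0] rule out [Hyu]; otherwise [le1] divided by [t] contradicts [Hyu]. *)
move: t0; rewrite le_eqVlt => /predU1P[t0|t0].
  have : \sum_j c j * u j <= 0.
    apply: (@le_trans _ _ (\sum_j (\sum_i y0 i * A i j) * u j)).
      by apply: ler_sum => j _; apply: ler_wpM2r.
    rewrite sum_mulC; apply: sumr_le0 => i _; apply: mulr_ge0_le0 => //.
    by rewrite (le_trans (Hu i)) // -t0 mul0r.
  have : 0 <= \sum_i y i * b i.
    apply: (@le_trans _ _ (\sum_i y i * \sum_j A i j * x0 j)).
      rewrite -sum_mulC; apply: sumr_ge0 => j _; apply: mulr_ge0 => //.
      by rewrite (le_trans _ (Hy j)) // -t0 mul0r.
    by apply: ler_sum => i _; apply: ler_wpM2l.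
  by lra.
move: le1; under eq_bigr do rewrite -mulrA.
under [X in _ <= X]eq_bigr do rewrite mulrCA.
by rewrite -!mulr_sumr ler_pM2l // leNgt Hyu.
Qed.

(** * Walks, lengths and flows *)

Fixpoint is_walk (S : finType) (N : network S) (x : node N)
    (w : seq (edge N)) (y : node N) : bool :=
  if w is e :: w' then (esrc e == x) && is_walk (etgt e) w' y else x == y.

Lemma is_walk_cat (S : finType) (N : network S) (x y z : node N) w1 w2 :
  is_walk x w1 y -> is_walk y w2 z -> is_walk x (w1 ++ w2) z.
Proof.
elim: w1 x => [|e w1 IH] x /=; first by move=> /eqP ->.
by move=> /andP[-> /IH H] /H.
Qed.

(** [s != t] and injectivity of [term] exclude the empty walk, so S-paths can be treated by
    induction on walks. *)
Lemma is_spath_walk (S : finType) (N : network S) (s t : S) (p : seq (edge N)) :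
  is_spath s t p =
  [&& s != t, is_walk (term N s) p (term N t) & uniq (term N s :: map (@etgt _ N) p)].
Proof.
case: p => [|e p] /=.
  by rewrite andbT (inj_eq (@term_inj _ N)); case: eqVneq.
have walk_path : is_walk (etgt e) p (term N t) =
    path (fun f g => etgt f == esrc g) e p && (etgt (last e p) == term N t).
  elim: p e => [|f p IH] e //=.
  by rewrite IH eq_sym andbA.
rewrite walk_path; case: (s != t) => //=; case: eqP => [->|//] /=.
by rewrite -!andbA.
Qed.

Lemma walk_suffix (R : realFieldType) (S : finType) (N : network S)
    (l : edge N -> R) (x y z : node N) (w : seq (edge N)) :
  (forall e, 0 <= l e) ->
  is_walk z w y -> uniq (z :: map (@etgt _ N) w) -> x \in z :: map (@etgt _ N) w ->
  exists w', [/\ is_walk x w' y, uniq (x :: map (@etgt _ N) w')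
               & \sum_(e <- w') l e <= \sum_(e <- w) l e].
Proof.
move=> l0; elim: w z => [|e w IH] z.
  by rewrite /= inE => zy _ /eqP ->; exists [::].
move=> Hw Hu; rewrite inE => /predU1P[->|xw]; first by exists (e :: w).
move: Hw Hu => /= /andP[_ Hw] /andP[_ Hu].
have [w' [? ? Hl]] := IH _ Hw Hu xw.
by exists w'; split=> //; rewrite (le_trans Hl) // big_cons lerDr.
Qed.

(** The tail is shortened first; if it returns to [x], its part from there on is taken, otherwise
    the first edge is put back. *)
Lemma walk_shorten (R : realFieldType) (S : finType) (N : network S)
    (l : edge N -> R) (x y : node N) (w : seq (edge N)) :
  (forall e, 0 <= l e) -> is_walk x w y ->
  exists w', [/\ is_walk x w' y, uniq (x :: map (@etgt _ N) w')
               & \sum_(e <- w') l e <= \sum_(e <- w) l e].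
Proof.
move=> l0; elim: w x => [|e w IH] x /=; first by move=> xy; exists [::].
move=> /andP[ex /IH[w' [Hw Hu Hl]]].
have [xw|xNw] := boolP (x \in etgt e :: map (@etgt _ N) w').
  have [w'' [? ? Hl']] := walk_suffix l0 Hw Hu xw.
  exists w''; split=> //; rewrite (le_trans Hl') // (le_trans Hl) //.
  by rewrite big_cons lerDr.
exists (e :: w'); split=> /=; first by rewrite ex.
  by rewrite xNw.
by rewrite !big_cons lerD2l.
Qed.

(** Feasibility for the linear program dual to the multiflow problem. *)
Definition path_dominating (R : realType) (S : finType) (mu : S -> S -> R)
    (N : network S) (l : edge N -> R) : Prop :=
  (forall e, 0 <= l e) /\
  (forall P : spath N,
     mu (path_start P) (path_end P) <= \sum_(e | e \in path_edges P) l e).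

Lemma sum_path_edges (R : realType) (S : finType) (N : network S)
    (P : spath N) (l : edge N -> R) :
  \sum_(e | e \in path_edges P) l e = \sum_(e <- path_edges P) l e.
Proof.
rewrite big_uniq //; have := valP P.
by rewrite is_spath_walk => /and3P[_ _ /andP[_ /map_uniq]].
Qed.

Lemma walk_dominated (R : realType) (S : finType) (mu : S -> S -> R)
    (N : network S) (l : edge N -> R) (s t : S) (w : seq (edge N)) :
  directed_distance mu -> path_dominating mu l ->
  is_walk (term N s) w (term N t) -> mu s t <= \sum_(e <- w) l e.
Proof.
move=> [mu0 muss] [l0 Hl] /(walk_shorten l0)[w' [Hw Hu Hle]].
apply: le_trans Hle; have [<-|st] := eqVneq s t; first by rewrite muss sumr_ge0.
have Hp : is_spath s t w' by rewrite is_spath_walk st Hw Hu.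
by have := Hl (exist _ (s, t, w') Hp : spath N); rewrite sum_path_edges.
Qed.

(** * Coordinatewise bounds for [Dinf] *)

Lemma le_Dplus (R : realType) (X : finType) (p q : X -> R) x :
  q x - p x <= Dplus p q.
Proof. by rewrite /Dplus; apply: (bigmax_sup x) => //; rewrite le_max lexx. Qed.

Lemma Dinf_le (R : realType) (S : finType) (p q : crvec R S) (v : R) :
  0 <= v -> (forall s, q (inl s) - p (inl s) <= v) ->
  (forall s, p (inr s) - q (inr s) <= v) -> Dinf p q <= v.
Proof.
move=> v0 Hc Hr; rewrite /Dinf /Dplus ge_max.
apply/andP; split; apply: bigmax_le => // s _; rewrite ge_max v0 andbT.
  exact: Hc.
exact: Hr.
Qed.

Lemma Dinf_ge0 (R : realType) (S : finType) (p q : crvec R S) : 0 <= Dinf p q.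
Proof. by rewrite /Dinf le_max /Dplus bigmax_ge_id. Qed.

Lemma Dinf_gel (R : realType) (S : finType) (p q : crvec R S) s :
  q (inl s) - p (inl s) <= Dinf p q.
Proof. by rewrite /Dinf le_max (le_Dplus (cpart p) (cpart q) s). Qed.

Lemma Dinf_ger (R : realType) (S : finType) (p q : crvec R S) s :
  p (inr s) - q (inr s) <= Dinf p q.
Proof. by rewrite /Dinf le_max (le_Dplus (rpart q) (rpart p) s) orbT. Qed.

(** * Locations from truncated distances *)

Section Potential.
Variables (R : realType) (S : finType) (mu : S -> S -> R) (N : network S).
Variable l : edge N -> R.
Hypotheses (hmu : directed_distance mu) (hl : path_dominating mu l).

(* The truncation at [mu_max] takes care of pairs of nodes not joined by any
   walk. *)
Let mu_max : R := \sum_s \sum_t mu s t.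

Let lengths (x y : node N) : set R :=
  [set v | v = mu_max \/ exists2 w, is_walk x w y & v = \sum_(e <- w) l e].

Definition trunc_dist (x y : node N) : R := inf (lengths x y).

Let mu_max_ge0 : 0 <= mu_max.
Proof. by case: hmu => mu0 _; apply: sumr_ge0 => s _; apply: sumr_ge0. Qed.

Let le_mu_max s t : mu s t <= mu_max.
Proof.
case: hmu => mu0 _; rewrite /mu_max (bigD1 s) //= (bigD1 t) //=.
rewrite -addrA lerDl addr_ge0 ?sumr_ge0 // => u _; exact: sumr_ge0.
Qed.

Let lengths_ge0 x y v : lengths x y v -> 0 <= v.
Proof.
case: hl => l0 _; case=> [->|[w _ ->]]; first exact: mu_max_ge0.
exact: sumr_ge0.
Qed.

Let lengths_neq0 x y : lengths x y !=set0.
Proof. by exists mu_max; left. Qed.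

Let trunc_dist_le x y v : lengths x y v -> trunc_dist x y <= v.
Proof. by apply: ge_inf; exists 0 => u; apply: lengths_ge0. Qed.

Lemma trunc_dist_ge0 x y : 0 <= trunc_dist x y.
Proof. by apply: lb_le_inf => // v; apply: lengths_ge0. Qed.

Lemma trunc_dist_diag x : trunc_dist x x = 0.
Proof.
apply/eqP; rewrite eq_le trunc_dist_ge0 andbT.
by apply: trunc_dist_le; right; exists [::]; rewrite ?big_nil /=.
Qed.

Lemma trunc_dist_etgt x (e : edge N) :
  trunc_dist x (etgt e) - trunc_dist x (esrc e) <= l e.
Proof.
rewrite lerBlDr -lerBlDl; apply: lb_le_inf => // v Hv.
rewrite lerBlDl; case: Hv => [->|[w Hw ->]].
  rewrite (@le_trans _ _ mu_max) ?lerDr //; last by case: hl.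
  by apply: trunc_dist_le; left.
apply: trunc_dist_le; right; exists (w ++ [:: e]).
  by apply: is_walk_cat Hw _; rewrite /= !eqxx.
by rewrite big_cat big_seq1 addrC.
Qed.

Lemma trunc_dist_esrc x (e : edge N) :
  trunc_dist (esrc e) x - trunc_dist (etgt e) x <= l e.
Proof.
rewrite lerBlDr -lerBlDl; apply: lb_le_inf => // v Hv.
rewrite lerBlDl; case: Hv => [->|[w Hw ->]].
  rewrite (@le_trans _ _ mu_max) ?lerDr //; last by case: hl.
  by apply: trunc_dist_le; left.
apply: trunc_dist_le; right; exists (e :: w).
  by rewrite /= eqxx.
by rewrite big_cons.
Qed.

(** A truncated value alone is at least [mu s t]; two actual walks concatenate to one from [s] to
    [t]. *)
Lemma mu_le_trunc_dist s t x :
  mu s t <= trunc_dist (term N s) x + trunc_dist x (term N t).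
Proof.
rewrite -lerBlDr; apply: lb_le_inf => // a Ha.
rewrite lerBlDr -lerBlDl; apply: lb_le_inf => // b Hb.
rewrite lerBlDl; have a0 := lengths_ge0 Ha; have b0 := lengths_ge0 Hb.
have := le_mu_max s t.
case: Ha => [->|[w Hw aE]]; first by lra.
case: Hb => [->|[w' Hw' bE]] _; first by have := le_mu_max s t; lra.
by rewrite aE bE -big_cat; apply: walk_dominated hl _ => //; apply: is_walk_cat Hw Hw'.
Qed.

(** The s^c-coordinate is the distance from [s], the s^r-coordinate the distance to [s]; their
    opposite variation along an edge matches the swap in [Dinf]. *)
Lemma location_of_lengths : exists rho : node N -> crvec R S,
  [/\ forall x, (Pmu mu `&` @nonneg R S) (rho x),
      forall s, rho (term N s) (inl s) = 0 /\ rho (term N s) (inr s) = 0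
    & forall e, Dinf (rho (esrc e)) (rho (etgt e)) <= l e].
Proof.
exists (fun x k => match k with
  | inl s => trunc_dist (term N s) x | inr s => trunc_dist x (term N s) end).
split=> [x|s|e].
- split=> [s t|[s|s]] /=; [exact: mu_le_trunc_dist|exact: trunc_dist_ge0..].
- by rewrite trunc_dist_diag.
- apply: Dinf_le => [|s|s]; first by case: hl.
    exact: trunc_dist_etgt.
  exact: trunc_dist_esrc.
Qed.

End Potential.

(** * Duality between multiflows and edge lengths *)

(** Nonnegativity makes both own coordinates of a terminal vanish. Along a path the s^c-coordinate
    thus goes from 0 to at least [mu s t], as the t^r-coordinate is 0 at the end. *)
Lemma location_dominating (R : realType) (S : finType) (mu : S -> S -> R)
    (N : network S) (A : set (crvec R S)) (rho : node N -> crvec R S) :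
  A `<=` Pmu mu `&` @nonneg R S -> is_location A rho ->
  path_dominating mu (fun e => Dinf (rho (esrc e)) (rho (etgt e))).
Proof.
move=> HA [Hrho Hterm]; split=> [e|P]; first exact: Dinf_ge0.
rewrite sum_path_edges; have := valP P; rewrite is_spath_walk => /and3P[_ Hw _].
move: Hw; rewrite -/(path_start P) -/(path_end P) -/(path_edges P).
move: (path_start P) (path_end P) (path_edges P) => s t w Hw.
have telescope x y u : is_walk x u y ->
    rho y (inl s) - rho x (inl s) <=
    \sum_(e <- u) Dinf (rho (esrc e)) (rho (etgt e)).
  elim: u x => [|e u IH] x /=; first by move=> /eqP ->; rewrite big_nil subrr.
  move=> /andP[/eqP <- /IH]; rewrite big_cons.
  by have := Dinf_gel (rho (esrc e)) (rho (etgt e)) s; lra.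
have := telescope _ _ _ Hw.
have [_ /= Hs] := Hterm s; have [_ /= Ht] := Hterm t.
have [_ Ns] := HA _ (Hrho (term N s)); have [Pt Nt] := HA _ (Hrho (term N t)).
have := Pt s t; have := Ns (inl s); have := Ns (inr s); have := Nt (inl t).
have := Nt (inr t); lra.
Qed.

Lemma multiflow_weak_duality (R : realType) (S : finType) (mu : S -> S -> R)
    (N : network S) (PP : {fset spath N}) (lam : spath N -> R) (l : edge N -> R) :
  is_multiflow PP lam -> path_dominating mu l ->
  flow_value mu PP lam <= \sum_e (cap e)%:R * l e.
Proof.
move=> [lam0 Hcap] [l0 Hl].
apply: (@le_trans _ _ (\sum_(P <- PP) \sum_(e | e \in path_edges P) lam P * l e)).
  rewrite /flow_value big_seq [leRHS]big_seq; apply: ler_sum => P PPP.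
  by rewrite -mulr_sumr ler_wpM2l ?lam0.
rewrite (exchange_big_dep xpredT) //=; apply: ler_sum => e _.
by rewrite -mulr_suml ler_wpM2r.
Qed.

Lemma spath_size (S : finType) (N : network S) (P : spath N) :
  (size (path_edges P) <= #|node N|)%N.
Proof.
have := valP P; rewrite is_spath_walk => /and3P[_ _ /card_uniqP].
set X := _ :: _ => cardX; have := max_card (mem X).
by rewrite cardX /= size_map => /ltnW.
Qed.

(** The linear program needs finitely many variables; simplicity bounds the number of edges of a
    path. *)
Lemma spath_finite (S : finType) (N : network S) :
  exists PP : {fset spath N}, forall P, P \in PP.
Proof.
pose J := {x : S * S * #|node N|.-bseq (edge N) | is_spath x.1.1 x.1.2 x.2}.
pose f (j : J) : spath N :=
  exist _ ((val j).1, (val j).2 : seq (edge N)) (valP j).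
exists [fset f j | j in {: J}]%fset => P; apply/imfsetP.
have HP := valP P.
exists (exist _ ((val P).1, Bseq (spath_size P)) HP : J) => //.
by apply: val_inj => /=; rewrite -surjective_pairing.
Qed.

Lemma multiflow_strong_duality (R : realType) (S : finType) (mu : S -> S -> R)
    (N : network S) : directed_distance mu ->
  exists (PP : {fset spath N}) (lam : spath N -> R) (l : edge N -> R),
    [/\ is_multiflow PP lam, path_dominating mu l
      & flow_value mu PP lam = \sum_e (cap e)%:R * l e].
Proof.
move=> [mu0 muss]; have [PP PPall] := spath_finite N.
pose m (P : PP) := mu (path_start (val P)) (path_end (val P)).
pose M (e : edge N) (P : PP) : R := (e \in path_edges (val P))%:R.
have sumM (P : PP) (y : edge N -> R) :
    \sum_e y e * M e P = \sum_(e | e \in path_edges (val P)) y e.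
  by rewrite [RHS]big_mkcond; apply: eq_bigr => e _; rewrite mulr_natr mulrb.
have sumM' e (x : PP -> R) :
    \sum_P M e P * x P = \sum_(P | e \in path_edges (val P)) x P.
  by rewrite [RHS]big_mkcond; apply: eq_bigr => P _; rewrite mulr_natl mulrb.
have mk0 (P : PP) : 0 <= m P by apply: mu0.
(* Feasible points: the zero flow, and the sum of all [m P] as the length of every edge, which
   suffices since a path has an edge. *)
have [||||x [y [x0 Hx y0 Hy xy]]] := @lp_duality R _ _ M (fun e => (cap e)%:R) m
    (fun=> 0) (fun=> \sum_P m P).
- by [].
- by move=> e; rewrite big1 ?ler0n // => P _; rewrite mulr0.
- by move=> _; apply: sumr_ge0.
- move=> P; rewrite sumM sum_path_edges.
  case: P {sumM sumM'} => [[[[s t] w] Hw] HP] /=.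
  case: w Hw HP => // e w Hw HP; rewrite big_cons /path_edges /=.
  set T := \sum_P m P; have T0 : 0 <= T by apply: sumr_ge0.
  rewrite (@le_trans _ _ T) ?lerDl ?sumr_ge0 //.
  by rewrite /T (bigD1 [` HP]%fset) //= lerDl sumr_ge0.
exists PP, (fun P => if insub P is Some Q then x Q else 0), y.
have domy : path_dominating mu y.
  by split=> // P; have := Hy [` PPall P]%fset; rewrite sumM.
have flowx : is_multiflow PP (fun P => if insub P is Some Q then x Q else 0).
  split=> [P _|e]; first by case: insubP.
  rewrite big_seq_fsetE /=; under eq_bigr do rewrite valK.
  by rewrite -sumM'.
split=> //; apply/eqP; rewrite eq_le multiflow_weak_duality //=.
rewrite /flow_value big_seq_fsetE /=; under eq_bigr do rewrite mulrC.
under [leRHS]eq_bigr do rewrite valK mulrC.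
exact: xy.
Qed.

(** An optimal dual [l] yields a location costing at most the optimal flow value, and weak duality
    forbids less. *)
Lemma MFP_FLP_of_location (R : realType) (S : finType) (mu : S -> S -> R)
    (N : network S) (A : set (crvec R S)) :
  directed_distance mu -> A `<=` Pmu mu `&` @nonneg R S ->
  (forall l : edge N -> R, path_dominating mu l ->
     exists2 rho : node N -> crvec R S, is_location A rho &
       location_cost rho <= \sum_e (cap e)%:R * l e) ->
  exists v : R, is_MFP mu N v /\ is_FLP A N v.
Proof.
move=> hmu HA Hloc.
have [PP [lam [l [Hlam Hl vE]]]] := multiflow_strong_duality N hmu.
have cost_ge (rho : node N -> crvec R S) : is_location A rho -> flow_value mu PP lam <= location_cost rho.
  by move=> Hrho; exact: multiflow_weak_duality Hlam (location_dominating HA Hrho).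
exists (flow_value mu PP lam); split; split.
- by exists PP, lam.
- move=> w [PP' [lam' [Hlam' ->]]]; rewrite vE; exact: multiflow_weak_duality.
- have [rho Hrho Hle] := Hloc l Hl; exists rho; split=> //.
  by apply/eqP; rewrite eq_le cost_ge //= vE.
- by move=> w [rho [Hrho ->]]; apply: cost_ge.
Qed.

(** * Retractions and sections *)

Lemma bigmax_sub_le (R : realDomainType) (T : finType) (b b' d : R) (f g : T -> R) :
  b' - b <= d -> (forall t, g t - f t <= d) ->
  \big[Num.max/b']_t g t - \big[Num.max/b]_t f t <= d.
Proof.
move=> hb hf; rewrite lerBlDr; apply: bigmax_le => [|t _].
  by rewrite -lerBlDr (le_trans _ hb) // lerB // bigmax_ge_id.
by rewrite -lerBlDr (le_trans _ (hf t)) // lerB // le_bigmax.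
Qed.

Section Retraction.
Variables (R : realType) (S : finType) (mu : S -> S -> R).

(* [base] is [fun=> 0] for the retraction onto [Tmu], and [-%R] for the one
   onto [Qmu], where it stands for the term [mu s s - p (inr s)], so that the
   maximum is never empty. *)
Variable base : R -> R.
Hypothesis base_nonexpansive : forall u v d, 0 <= d -> u - v <= d -> base v - base u <= d.
Hypothesis base_le : forall u v w, base w <= u -> base u <= v -> base v <= u.

Let base_antitone u v : u <= v -> base v <= base u.
Proof. by have := @base_nonexpansive u v 0 (lexx 0); rewrite !subr_le0. Qed.

Definition tighten_c (p : crvec R S) : S -> R :=
  fun s => \big[Num.max/base (p (inr s))]_t (mu s t - p (inr t)).

(** The r-part is lowered against the new c-part, which puts the result in [Pmu] for any [p]. *)
Definition tighten (p : crvec R S) : crvec R S := fun k =>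
  match k with
  | inl s => tighten_c p s
  | inr t => \big[Num.max/base (tighten_c p t)]_s (mu s t - tighten_c p s)
  end.

(** Nonnegativity for the zero [base]; for [-%R], the condition that p(s^c) + p(s^r) be
    nonnegative. *)
Definition above_base (p : crvec R S) : Prop := forall s,
  base (p (inr s)) <= p (inl s) /\ base (p (inl s)) <= p (inr s).

Lemma tighten_Pmu p : Pmu mu (tighten p).
Proof.
move=> s t /=; rewrite -lerBlDl.
exact: (le_bigmax _ (fun s => mu s t - tighten_c p s)).
Qed.

Lemma tighten_le p : Pmu mu p -> above_base p -> vle (tighten p) p.
Proof.
move=> Hp Hb [s|t] /=.
  apply: bigmax_le => [|t _]; first by case: (Hb s).
  by rewrite lerBlDr.
(* Lowering the c-coordinate may raise its [base], but [base_le] keeps this below p(t^r). *)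
apply: bigmax_le => [|s _]; first apply: (@base_le _ _ (p (inl t))).
  - by case: (Hb t).
  - exact: bigmax_ge_id.
rewrite lerBlDl -lerBlDr; exact: (le_bigmax _ (fun t => mu s t - p (inr t))).
Qed.

(** Each c-coordinate is a maximum of terms decreasing in the r-part, and conversely; the opposite
    orientations in [Dinf] absorb the sign. *)
Lemma tighten_nonexpansive p q : Dinf (tighten p) (tighten q) <= Dinf p q.
Proof.
have D0 := Dinf_ge0 p q.
have Hc s : tighten_c q s - tighten_c p s <= Dinf p q.
  apply: bigmax_sub_le => [|t].
    by apply: base_nonexpansive => //; apply: Dinf_ger.
  by have := Dinf_ger p q t; lra.
apply: Dinf_le => // t /=.
apply: bigmax_sub_le => [|s].
  exact: base_nonexpansive.
by have := Hc s; lra.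
Qed.

(** Since [q] lies below [p] and below its tightening, its own constraints force each coordinate up
    to the maximum defining [tighten]. *)
Lemma tighten_minimal p q : Pmu mu p -> above_base p -> Pmu mu q -> above_base q ->
  vle q (tighten p) -> q = tighten p.
Proof.
move=> Hp Hb Hq Hbq qle; apply/funext => k; apply/eqP; rewrite eq_le qle /=.
have le_p := tighten_le Hp Hb.
case: k => [s|t] /=.
  apply: bigmax_le => [|t _].
    case: (Hbq s) => Hs _; apply: le_trans Hs; apply: base_antitone.
    exact: le_trans (qle _) (le_p _).
  have := Hq s t; have := qle (inr t); have := le_p (inr t); lra.
apply: bigmax_le => [|s _].
  by case: (Hbq t) => _; apply: le_trans; apply: base_antitone; apply: (qle (inl t)).
by have := Hq s t; have := qle (inl s); rewrite /=; lra.
Qed.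

End Retraction.

Section RetractionT.
Variables (R : realType) (S : finType) (mu : S -> S -> R).

Let base : R -> R := fun=> 0.

Lemma tighten_Tmu p : (Pmu mu `&` @nonneg R S) p -> Tmu mu (tighten mu base p).
Proof.
move=> [Hp p0]; split.
  by split; [exact: tighten_Pmu | case=> s; apply: bigmax_ge_id].
move=> [q [[Hq q0] qN qle]]; apply: qN; apply: tighten_minimal qle => //.
by move=> u v d d0 _; rewrite subrr.
Qed.

Lemma tightenT_nonexpansive p q :
  Dinf (tighten mu base p) (tighten mu base q) <= Dinf p q.
Proof. by apply: tighten_nonexpansive => u v d d0 _; rewrite subrr. Qed.

Lemma tightenT_le p : (Pmu mu `&` @nonneg R S) p -> vle (tighten mu base p) p.
Proof. by move=> [Hp p0]; apply: tighten_le => // s; split; apply: p0. Qed.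

End RetractionT.

Section RetractionQ.
Variables (R : realType) (S : finType) (mu : S -> S -> R).
Hypothesis hmu : directed_distance mu.

Let base : R -> R := -%R.

Let above q : Pmu mu q -> above_base base q.
Proof.
by case: hmu => _ muss Hq s; have := Hq s s; rewrite muss /base; split; lra.
Qed.

Lemma tighten_Qmu p : Pmu mu p -> Qmu mu (tighten mu base p).
Proof.
move=> Hp; split; first exact: tighten_Pmu.
move=> [q [Hq qN qle]]; apply: qN; apply: tighten_minimal qle => //.
- by move=> u v d d0; rewrite /base; lra.
- by move=> u v w; rewrite /base; lra.
- exact: above.
- exact: above.
Qed.

Lemma tightenQ_nonexpansive p q :
  Dinf (tighten mu base p) (tighten mu base q) <= Dinf p q.
Proof. by apply: tighten_nonexpansive => u v d d0; rewrite /base; lra. Qed.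

Lemma tightenQ_le p : Pmu mu p -> vle (tighten mu base p) p.
Proof.
move=> Hp; apply: tighten_le => //; last exact: above.
by move=> u v w; rewrite /base; lra.
Qed.

End RetractionQ.

(** * Equality of the optima *)

Lemma Tmu_MFP_FLP (R : realType) (S : finType) (mu : S -> S -> R) (N : network S) :
  directed_distance mu -> exists v : R, is_MFP mu N v /\ is_FLP (Tmu mu) N v.
Proof.
move=> hmu; apply: MFP_FLP_of_location => // [p [] //|l Hl].
have [rho [Hrho Hterm Hcost]] := location_of_lengths hmu Hl.
have HT x := tighten_Tmu (Hrho x).
exists (fun x => tighten mu (fun=> 0) (rho x)).
  split=> // s; split=> //=.
  have [_ nonneg_s] := (HT (term N s)).1; have le_s := tightenT_le (Hrho (term N s)).
  have := nonneg_s (inl s); have := nonneg_s (inr s).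
  have := le_s (inl s); have := le_s (inr s); have [-> ->] := Hterm s.
  rewrite /=; lra.
apply: ler_sum => e _; rewrite ler_wpM2l // (le_trans _ (Hcost e)) //.
exact: tightenT_nonexpansive.
Qed.

(* Translating along [L] shifts all the coordinatewise differences that make up
   [Dinf] by the same amount; balancedness keeps their maximum nonnegative. *)
Lemma Dinf_translate (R : realType) (S : finType) (A : set (crvec R S))
    (p q p' q' : crvec R S) (a b : R) : balanced A -> A p' -> A q' ->
  (forall k, p' k = p k + a * Ldir R k) -> (forall k, q' k = q k + b * Ldir R k) ->
  Dinf p' q' <= Dinf p q + (b - a).
Proof.
move=> balA Ap' Aq' pE qE.
have Hc s : q' (inl s) - p' (inl s) <= Dinf p q + (b - a).
  by have := Dinf_gel p q s; rewrite pE qE /=; lra.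
apply: Dinf_le => // [|s].
  have /existsNP[s /negP] : ~ vlt (cpart q') (cpart p').
    by move=> H; apply: balA; exists q', p'; split=> //; left.
  by have := Hc s; rewrite -leNgt /cpart; lra.
by have := Dinf_ger p q s; rewrite pE qE /=; lra.
Qed.

(** Regrouped by nodes, [x] contributes [a x] times its entering minus leaving capacity: zero by the
    Eulerian condition or because [a] vanishes. *)
Lemma eulerian_circulation (R : realType) (S : finType) (N : network S)
    (a : node N -> R) : inner_eulerian N -> (forall s, a (term N s) = 0) ->
  \sum_(e : edge N) (cap e)%:R * (a (etgt e) - a (esrc e)) = 0.
Proof.
move=> eulN a0; under eq_bigr do rewrite mulrBr.
rewrite sumrB (partition_big (@etgt _ N) xpredT) //=.
rewrite [X in _ - X](partition_big (@esrc _ N) xpredT) //= -sumrB.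
apply: big1 => x _.
under eq_bigr => e /eqP -> do [].
under [X in _ - X]eq_bigr => e /eqP -> do [].
have [/codomP[s ->]|xN] := boolP (x \in codom (@term S N)).
  by rewrite a0 !big1 ?subrr // => e _; rewrite mulr0.
by rewrite -!mulr_suml -!natr_sum eulN // subrr.
Qed.

Lemma section_MFP_FLP (R : realType) (S : finType) (mu : S -> S -> R)
    (A : set (crvec R S)) (N : network S) :
  directed_distance mu -> is_section mu A -> balanced A -> A `<=` Qmu_nonneg mu ->
  inner_eulerian N -> exists v : R, is_MFP mu N v /\ is_FLP A N v.
Proof.
move=> hmu [_ [_ _ secA]] balA AQ eulN.
have AP p : A p -> (Pmu mu `&` @nonneg R S) p by move=> /AQ[[]].
apply: MFP_FLP_of_location => // l Hl.
have [rho [Hrho Hterm Hcost]] := location_of_lengths hmu Hl.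
have HP x := (Hrho x).1.
pose sigma x := tighten mu -%R (rho x).
(* Tightening only lowers the two zeros, while their sum stays at least [mu s s = 0]. *)
have sigma_term s : sigma (term N s) (inl s) = 0 /\ sigma (term N s) (inr s) = 0.
  have le_s := tightenQ_le hmu (HP (term N s)).
  have := tighten_Pmu mu -%R (rho (term N s)) s s; rewrite hmu.2 -/(sigma _).
  have := le_s (inl s); have := le_s (inr s); rewrite -/(sigma _).
  by have [-> ->] := Hterm s; lra.
(* The section meets the coset of each [sigma x]; the translation coefficient is recorded as the
   potential. *)
have /choice[tau Htau] x : exists pa : crvec R S * R,
    A pa.1 /\ forall k, pa.1 k = sigma x k + pa.2 * Ldir R k.
  have [p Ap eqL] : exists2 p, A p & Lcoset p = Lcoset (sigma x).
    by apply: secA; exists (sigma x) => //; apply: tighten_Qmu.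
  have : Lcoset p p by exists 0 => k; rewrite mul0r addr0.
  by rewrite eqL => -[a pE]; exists (p, a).
have HA x := (Htau x).1; have tauE x := (Htau x).2.
(* The translated own coordinates are the coefficient and its negative, both nonnegative. *)
have a0 s : (tau (term N s)).2 = 0.
  have [_ tau0] := AP _ (HA (term N s)).
  have := tau0 (inl s); have := tau0 (inr s); rewrite !tauE.
  by have [-> ->] := sigma_term s; rewrite /=; lra.
exists (fun x => (tau x).1).
  split=> // s; split=> //=; rewrite !tauE a0 !mul0r.
  by have [-> ->] := sigma_term s; rewrite !addr0.
have circ := @eulerian_circulation R S N (fun x => (tau x).2) eulN a0.
(* The zero circulation is added to the bound so that edges can be compared one by one. *)
rewrite -[leRHS]addr0 -[X in _ + X]circ -big_split /=.
apply: ler_sum => e _; rewrite -mulrDr ler_wpM2l //.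
rewrite (le_trans (Dinf_translate balA (HA _) (HA _) (tauE _) (tauE _))) // lerD2r.
apply: le_trans (Hcost e); exact: tightenQ_nonexpansive.
Qed.

Theorem theorem2p2 (R : realType) (S : finType) (mu : S -> S -> R)
    (hmu : directed_distance mu) :
  (forall N : network S,
     exists v : R, is_MFP mu N v /\ is_FLP (Tmu mu) N v) /\
  (forall A : set (crvec R S),
     is_section mu A -> balanced A -> A `<=` Qmu_nonneg mu ->
     forall N : network S, inner_eulerian N ->
       exists v : R, is_MFP mu N v /\ is_FLP A N v).
Proof.
split=> [N|A secA balA AQ N eulN]; first exact: Tmu_MFP_FLP.
exact: section_MFP_FLP.
Qed.
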